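(* Let $e\ge3$ be an odd integer, let $b=2^{e-1}$, and let $\mathcal{R}$, $\mathcal{P}$, $\mathcal{P}_0$, $\mathcal{T}$, $H$ and $\lambda_\alpha$ be as described in the context. Let \[ S_0=\{0\},\ S_1=(\mathcal{T}\setminus\{1\})H,\ S_2=(\mathcal{T}\setminus\{1\})(-H),\ S_3=H,\ S_4=-H,\ S_5=\mathcal{P}_0\setminus\{0\},\ S_6=\mathcal{P}\setminus\mathcal{P}_0 . \] Then for each $i,j\in\{0,1,\dots,6\}$ the value $\lambda_\alpha(S_j)$ does not depend on the choice of $\alpha\in S_i$. Writing $p_{i,j}=\lambda_\alpha(S_j)$ for $\alpha\in S_i$, the matrix $(p_{i,j})_{0\le i,j\le 6}$ equals \[ \begin{pmatrix} 1&2b(b-1)&2b(b-1)&b&b&b-1&b\\ 1&bi&-bi&0&0&-1&0\\ 1&-bi&bi&0&0&-1&0\\ 1&0&0&bi&-bi&b-1&-b \\ 1&0&0&-bi&bi&b-1&-b \\ 1&-2b&-2b&b&b&b-1&b \\ 1&0&0&-b&-b&b-1&b \end{pmatrix}. \] In particular, setting $R_j=\{(\alpha,\beta)\in\mathcal{R}\times\mathcal{R}:\alpha-\beta\in S_j\}$ for $j=0,\dots,6$, the pair $\mathfrak{X}=(\mathcal{R},\{R_j\}_{j=0}^6)$ is a nonsymmetric association scheme of class $6$ whose first eigenmatrix is the matrix above.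
   Context: Let $e\ge 3$ be odd, $F=\mathrm{GF}(2)$, $K=\mathrm{GF}(2^e)=F[x]/(\varphi(x))$ with $\varphi$ a primitive polynomial of degree $e$ over $F$ and $\zeta$ a root of $\varphi$ in $K$; $\mathrm{Tr}:K\to F$ is the absolute trace. Let $\mathcal{A}=\mathbb{Z}/4\mathbb{Z}$ and let $\Phi(x)\in\mathcal{A}[x]$ be monic with $\Phi\equiv\varphi \pmod{2\mathcal{A}[x]}$ and $\Phi$ dividing $x^{2^e-1}-1$ in $\mathcal{A}[x]$. The Galois ring is $\mathcal{R}=\mathcal{A}[x]/(\Phi(x))$; it is local with maximal ideal $\mathcal{P}=2\mathcal{R}$ and $\mathcal{R}/\mathcal{P}\cong K$, with the image $\xi$ of $x$ mapped to $\zeta$. Let $\mathcal{T}=\langle\xi\rangle$, cyclic of order $2^e-1$; each $\alpha\in\mathcal{R}$ is uniquely $\alpha_0+2\alpha_1$ with $\alpha_0,\alpha_1\in\mathcal{T}\cup\{0\}$. Let $\mathcal{T}_0=\{\xi^j: 0\le j\le 2^e-2,\ \mathrm{Tr}(\zeta^j)=0\}$, $\mathcal{P}_0=2\mathcal{T}_0\cup\{0\}$ and $H=1+\mathcal{P}_0$. The Frobenius automorphism $f$ of $\mathcal{R}$ is the ring automorphism with $(\alpha_0+2\alpha_1)^f=\alpha_0^2+2\alpha_1^2$, and $\mathcal{S}(\alpha)=\alpha+\alpha^f+\dots+\alpha^{f^{e-1}}\in\mathcal{A}$. Define $\chi(\alpha)=i^{e\mathcal{S}(\alpha)}$ with $i^2=-1$,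 and for $\alpha\in\mathcal{R}$, $A\subseteq\mathcal{R}$ set $\lambda_\alpha(A)=\sum_{\beta\in A}\chi(\alpha\beta)$. Products of sets mean $AB=\{ab:a\in A,b\in B\}$ and $-H=\{-h:h\in H\}$. The first eigenmatrix $(P_{k,j})$ of a commutative association scheme with adjacency matrices $A_j$ and primitive idempotents $E_k$ is defined by $A_j=\sum_k P_{k,j}E_k$. *)

(* Defs.v *)
From HB Require Import structures.
From mathcomp Require Export all_boot all_order all_algebra all_field.

Set Implicit Arguments.
Unset Strict Implicit.
Unset Printing Implicit Defensive.

Import GRing.Theory Num.Theory.
Local Open Scope ring_scope.

(** * Association schemes *)

Section AssociationScheme.

Variables (X : finType) (d : nat).
Implicit Type Rl : 'I_d.+1 -> {set X * X}.

Definition converse (r : {set X * X}) : {set X * X} :=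
  [set p | (p.2, p.1) \in r].

Definition inter_number Rl (i j : 'I_d.+1) (x y : X) : nat :=
  #|[set z | ((x, z) \in Rl i) && ((z, y) \in Rl j)]|.

(* The scheme is not required to be symmetric: the converse of a relation is
   only required to be one of the relations. *)
Definition association_scheme Rl : Prop :=
  [/\ Rl ord0 = [set p | p.1 == p.2],
      forall i, Rl i != set0,
      forall p, exists! i, p \in Rl i,
      forall i, exists i', converse (Rl i) = Rl i'
    & forall i j k, exists n : nat, forall x y,
        (x, y) \in Rl k -> inter_number Rl i j x y = n].

Definition commutative_relations Rl : Prop :=
  forall i j x y, inter_number Rl i j x y = inter_number Rl j i x y.

Definition symmetric_relations Rl : Prop :=
  forall i, converse (Rl i) = Rl i.

Variable C : numClosedFieldType.

Definition adjacency (r : {set X * X}) : 'M[C]_#|X| :=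
  \matrix_(x, y) ((enum_val x, enum_val y) \in r)%:R.

Definition bose_mesner Rl : {vspace 'M[C]_#|X|} :=
  <<[seq adjacency (Rl i) | i : 'I_d.+1]>>%VS.

Definition bm_idempotent Rl (E : 'M[C]_#|X|) : Prop :=
  E \in bose_mesner Rl /\ E *m E = E.

Definition primitive_idempotent Rl (E : 'M[C]_#|X|) : Prop :=
  [/\ bm_idempotent Rl E, E != 0
    & forall F G, bm_idempotent Rl F -> bm_idempotent Rl G ->
        F *m G = 0 -> G *m F = 0 -> E = F + G -> F = 0 \/ G = 0].

(* The primitive idempotents carry no canonical order, apart from the usual
   convention E_0 = |X|^-1 J; hence a first eigenmatrix is relative to an
   enumeration E of them. *)
Definition first_eigenmatrix Rl (P : 'M[C]_d.+1) : Prop :=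
  exists E : 'I_d.+1 -> 'M[C]_#|X|,
    [/\ injective E,
        E ord0 = (#|X|%:R)^-1 *: const_mx 1,
        forall F, primitive_idempotent Rl F <-> exists k, F = E k
      & forall j, adjacency (Rl j) = \sum_k P k j *: E k].

End AssociationScheme.

(** * The Galois ring of characteristic 4 *)

Definition red2 (a : 'Z_4) : 'F_2 := (a : nat)%:R.

(* The absolute trace of GF(2 ^ e), with values in the prime subfield. *)
Definition abs_trace (K : fieldType) (e : nat) (x : K) : K :=
  \sum_(k < e) x ^+ (2 ^ k).

Section GaloisRing.

Variables (e : nat) (Phi : {poly 'Z_4}).

Notation GR := {poly %/ Phi}.

Definition xi : GR := 'qX.

Definition setmul (A B : {set GR}) : {set GR} :=
  [set (a : GR) * (b : GR) | a in A, b in B].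
Definition setopp (A : {set GR}) : {set GR} := [set - (a : GR) | a in A].

Definition maxideal : {set GR} := [set 2%:R * x | x : GR].

Definition teich : {set GR} := [set xi ^+ j | j : 'I_(2 ^ e - 1)].

(* The pair (a0, a1) of elements of teich U {0} with x = a0 + 2 a1; it is
   unique when GR is a Galois ring, and the default value is then not used. *)
Definition teich_digits (x : GR) : GR * GR :=
  odflt (0, 0) [pick a : GR * GR |
    [&& a.1 \in 0 |: teich, a.2 \in 0 |: teich & x == a.1 + 2%:R * a.2]].

Definition frob (x : GR) : GR :=
  let a := teich_digits x in a.1 ^+ 2 + 2%:R * a.2 ^+ 2.

(* The sum of the conjugates of x lies in 'Z_4, i.e. it is represented by a
   constant polynomial; taking the constant coefficient reads off this value. *)
Definition gtrace (x : GR) : 'Z_4 := (\sum_(k < e) iter k frob x)`_0.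

Section Subsets.

Variables (K : fieldType) (zeta : K).

Definition teich0 : {set GR} :=
  [set xi ^+ j | j : 'I_(2 ^ e - 1) & abs_trace e (zeta ^+ j) == 0].

Definition maxideal0 : {set GR} := 0 |: [set 2%:R * (t : GR) | t in teich0].

Definition subgroupH : {set GR} := [set 1 + (x : GR) | x in maxideal0].

Definition Sset : 'I_7 -> {set GR} := tnth [tuple
  [set (0 : GR)];
  setmul (teich :\ (1 : GR)) subgroupH;
  setmul (teich :\ (1 : GR)) (setopp subgroupH);
  subgroupH;
  setopp subgroupH;
  maxideal0 :\ (0 : GR);
  maxideal :\: maxideal0].

Definition Rrel (j : 'I_7) : {set GR * GR} :=
  [set p | p.1 - p.2 \in Sset j].

End Subsets.

Variable C : numClosedFieldType.

Definition chi (x : GR) : C := 'i ^+ (e * gtrace x).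

Definition lambda (x : GR) (A : {set GR}) : C := \sum_(y in A) chi (x * y).

End GaloisRing.

Definition eigen_table (C : numClosedFieldType) (e : nat) : 'M[C]_7 :=
  let b : C := 2%:R ^+ (e - 1) in
  let m := 2%:R * b * (b - 1) in
  \matrix_(i, j) nth 0 (nth [::] [::
    [:: 1;       m;          m;          b;         b;         b - 1;  b];
    [:: 1;       b * 'i;     - b * 'i;   0;         0;         - 1;    0];
    [:: 1;       - b * 'i;   b * 'i;     0;         0;         - 1;    0];
    [:: 1;       0;          0;          b * 'i;    - b * 'i;  b - 1;  - b];
    [:: 1;       0;          0;          - b * 'i;  b * 'i;    b - 1;  - b];
    [:: 1;       - 2%:R * b; - 2%:R * b; b;         b;         b - 1;  b];
    [:: 1;       0;          0;          - b;       - b;       b - 1;  b]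
  ] i) j.

(* Main.v *)
From HB Require Import structures.
Require Import Defs.
From mathcomp Require Import all_boot all_order all_algebra all_field.
From mathcomp Require Import ring.

Set Implicit Arguments.
Unset Strict Implicit.
Unset Printing Implicit Defensive.

Import GRing.Theory Num.Theory.
Local Open Scope ring_scope.

(* The form (x, y) |-> chi (x y) is a nondegenerate bicharacter of the additive
   group of the Galois ring, and the character sums of the classes S_j are
   constant on each class S_i.  Hence the class sums of characters are the
   primitive idempotents, so that the translation relations form a scheme with
   the table of character sums as its first eigenmatrix.

   The sums are computed through the residue field K.  Every x is uniquely
   tau a + 2 t, with tau a the Teichmueller lift of the residue a of x and t
   determined modulo 2.  As chi (2 t) = (-1) ^ Tr t, a sum over maxideal0 is a
   sum of an additive character of K over the hyperplane Tr = 0, and it vanishes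
   unless the residue of x is 0 or 1.  The additivity of frob comes from
   tau a + tau b = tau (a + b) + 2 sqrt (a b), which holds because squares in
   the Galois ring only depend on residues. *)

(** * Translation schemes *)

Section TranslationScheme.

Variables (G : finZmodType) (C : numClosedFieldType) (d : nat).
Variables (B : G -> G -> C) (S : 'I_d.+1 -> {set G}) (P : 'M[C]_d.+1).

Hypothesis B_sym : forall x y, B x y = B y x.
Hypothesis B_add : forall x y z, B (x + y) z = B x z * B y z.
Hypothesis B_sum : forall x, \sum_y B x y = #|G|%:R * (x == 0)%:R.
Hypothesis S_0 : S ord0 = [set 0].
Hypothesis S_cover : forall x, exists i, x \in S i.
Hypothesis S_opp : forall i, exists j, forall x, (- x \in S i) = (x \in S j).
Hypothesis B_S : forall i j x, x \in S i -> \sum_(y in S j) B x y = P i j.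
Hypothesis S_uniq : forall x i j, x \in S i -> x \in S j -> i = j.
Hypothesis P0_neq0 : forall j, P ord0 j != 0.

Let Rl (j : 'I_d.+1) : {set G * G} := [set p | p.1 - p.2 \in S j].

Let n : C := #|G|%:R.

Let n_neq0 : n != 0.
Proof. by rewrite pnatr_eq0 -lt0n; apply/card_gt0P; exists 0. Qed.

(** If [B 0 0] were zero, additivity would kill every [B 0 y], against their sum [#|G|]. So each
    [B 0 x] is nonzero, and it is idempotent. *)
Let B0x x : B 0 x = 1.
Proof.
have B0_neq0 : B 0 0 != 0.
  apply/eqP => B00; have /eqP := B_sum 0.
  rewrite eqxx mulr1 big1 ?(eq_sym 0) ?(negPf n_neq0) // => y _.
  by rewrite B_sym -[y]addr0 B_add B00 mulr0.
have Bx0 y : B 0 y != 0.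
  apply/eqP => B0y; case/eqP: B0_neq0.
  by rewrite -{2}(subrr y) B_sym B_add -!(B_sym 0) B0y mul0r.
by apply: (mulfI (Bx0 x)); rewrite -B_add addr0 mulr1.
Qed.

Let B_addr x y z : B x (y + z) = B x y * B x z.
Proof. by rewrite !(B_sym x) B_add. Qed.

Let B_neg x y : B (- x) y = B x (- y).
Proof.
have Bxy : B x y != 0.
  apply/eqP => Bxy; have /eqP := B0x y.
  by rewrite -(subrr x) B_add Bxy mul0r eq_sym oner_eq0.
by apply: (mulfI Bxy); rewrite -B_add -B_addr !subrr (B_sym x) !B0x.
Qed.

(** An empty class would make the entry of [P] in row 0, which is a sum over that class, vanish. *)
Let S_neq0 i : exists x, x \in S i.
Proof.
have [Si0|] := eqVneq (S i) set0; last by case/set0Pn=> x; exists x.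
case/eqP: (P0_neq0 i); rewrite -(@B_S ord0 i 0) ?S_0 ?inE //.
by rewrite Si0 big_set0.
Qed.

(** * Adjacency matrices and character idempotents *)

Let A j : 'M[C]_#|G| := adjacency C (Rl j).

(** This is the sum of the rank-one projections attached to the characters [B a], [a \in S k]. The
    argument is [y - x], not [x - y], so that [A j] acts on the image by [P k j] itself and not by
    the sum over the opposite class. *)
Let E (k : 'I_d.+1) : 'M[C]_#|G| :=
  \matrix_(x, y) (n^-1 * \sum_(a in S k) B a (enum_val y - enum_val x)).

Let A_entry j x y : A j x y = (enum_val x - enum_val y \in S j)%:R.
Proof. by rewrite mxE inE. Qed.

Let E_entry k l x y : enum_val y - enum_val x \in S l -> E k x y = n^-1 * P l k.
Proof.
move=> Hl; rewrite mxE -(B_S _ Hl); congr (_ * _).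
by apply: eq_bigr => a _; rewrite B_sym.
Qed.

Let sum_enum (F : G -> C) : \sum_(i < #|G|) F (enum_val i) = \sum_x F x.
Proof.
by rewrite (reindex (@enum_val G G)) //=; apply: onW_bij; apply: enum_val_bij.
Qed.

(** Orthogonality of characters: the inner sum over [y] of [B (a - b) y] keeps only [a = b], which
    is impossible for distinct, hence disjoint, classes. *)
Let E_mul k l : E k *m E l = if k == l then E k else 0.
Proof.
apply/matrixP => i j; rewrite mxE.
set x := enum_val i; set z := enum_val j.
have termE y a b : B a (y - x) * B b (z - y) = B a (- x) * B b z * B (a - b) y.
  by rewrite !B_addr B_add B_neg; ring.
transitivity (\sum_y (n^-1 * \sum_(a in S k) B a (y - x)) *
                (n^-1 * \sum_(b in S l) B b (z - y))).
  by rewrite -sum_enum; apply: eq_bigr => y _; rewrite !mxE.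
transitivity (n^-1 * \sum_(a in S k) (a \in S l)%:R * B a (z - x)).
  under eq_bigr do rewrite mulrACA big_distrlr /=.
  rewrite -big_distrr /= -mulrA; congr (_ * _).
  rewrite exchange_big big_distrr /=; apply: eq_bigr => a _.
  rewrite exchange_big /=.
  under eq_bigr => b _.
    under eq_bigr do rewrite termE.
    rewrite -big_distrr /= B_sum subr_eq0.
    over.
  have [al|al] := boolP (a \in S l).
    rewrite (bigD1 a) //= eqxx big1 => [|b /andP[_ /negPf ba]].
      by rewrite addr0 mulr1 mulrCA mulVf // mulr1 mul1r B_addr mulrC.
    by rewrite eq_sym ba !mulr0.
  rewrite mul0r big1 ?mulr0 // => b bl.
  by have [eab|_] := eqVneq a b; [rewrite eab bl in al | rewrite !mulr0].
have [<-|kl] := eqVneq k l.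
  by rewrite mxE; congr (_ * _); apply: eq_bigr => a ->; rewrite mul1r.
rewrite mxE big1 ?mulr0 // => a ak.
have [al|_] := boolP (a \in S l); last by rewrite mul0r.
by rewrite (S_uniq ak al) eqxx in kl.
Qed.

Let sum_S (g : G -> C) : \sum_k \sum_(a in S k) g a = \sum_a g a.
Proof.
under eq_bigr do rewrite big_mkcond /=.
rewrite exchange_big /=; apply: eq_bigr => a _.
have [k ak] := S_cover a; rewrite (bigD1 k) //= ak big1 ?addr0 // => l lk.
by case: ifP => // al; rewrite (S_uniq ak al) eqxx in lk.
Qed.

(** Fourier inversion: the classes cover [G], so the double sum runs over all [a], and summing over
    [a] detects [s = x - y]. *)
Let adjacencyE j : A j = \sum_k P k j *: E k.
Proof.
apply/matrixP => p q; rewrite summxE A_entry.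
set x := enum_val p; set y := enum_val q.
transitivity (\sum_k \sum_(a in S k) n^-1 * \sum_(s in S j) B (s + (y - x)) a).
  rewrite sum_S -big_distrr /= exchange_big /=.
  under eq_bigr do rewrite B_sum -/n.
  rewrite -big_distrr /= mulKf // -natr_sum; congr (_%:R).
  have [xy|xy] := boolP (_ \in _).
    rewrite (bigD1 (x - y)) //= addrA subrK subrr eqxx big1 // => s.
    case/andP=> _ sxy.
    by rewrite -opprB subr_eq0 (negPf sxy).
  rewrite big1 // => s sj; rewrite -opprB subr_eq0.
  by apply/eqP; rewrite eqb0; apply: contraNneq xy => <-.
apply: eq_bigr => k _; rewrite !mxE mulrCA -big_distrr /=; congr (_ * _).
rewrite big_distrr /=; apply: eq_bigr => a ak.
rewrite -(B_S _ ak) big_distrl /=; apply: eq_bigr => s _.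
by rewrite B_add (B_sym s) (B_sym _ a).
Qed.

Let E_neq0 k : E k != 0.
Proof.
have [x xk] := S_neq0 k; apply/eqP => /matrixP/(_ (enum_rank 0) (enum_rank 0)).
rewrite !mxE subrr; under eq_bigr do rewrite B_sym B0x.
rewrite sumr_const => /eqP; rewrite mulf_eq0 invr_eq0 (negPf n_neq0) /=.
by rewrite pnatr_eq0 -leqn0 leqNgt => /negP[]; apply/card_gt0P; exists x.
Qed.

Let memA i : A i \in bose_mesner C Rl.
Proof. by apply: memv_span; apply/imageP; exists i. Qed.

(** The entries of [E k] depend only on the class of [y - x], so [E k] is a combination of
    transposed adjacency matrices; [S_opp] makes each of these an adjacency matrix again. *)
Let memE k : E k \in bose_mesner C Rl.
Proof.
suff -> : E k = \sum_l n^-1 * P l k *: (A l)^T.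
  apply: memv_suml => l _; apply: memvZ.
  have [j Hj] := S_opp l; suff -> : (A l)^T = A j by apply: memA.
  by apply/matrixP => x y; rewrite mxE !A_entry -Hj opprB.
apply/matrixP => x y; have [l xy] := S_cover (enum_val y - enum_val x).
rewrite (E_entry _ xy) summxE (bigD1 l) //= big1 => [|m ml].
  by rewrite !mxE inE xy mulr1 addr0.
rewrite 3!mxE inE; case: (boolP (_ \in S m)) => [xym|_]; last by rewrite mulr0.
by rewrite (S_uniq xy xym) eqxx in ml.
Qed.

(** * Primitive idempotents in the basis [E] *)

Let bmP F : F \in bose_mesner C Rl -> exists c, F = \sum_k c k *: E k.
Proof.
pose X := [tuple E k | k < d.+1].
have /subvP sub_BX : (bose_mesner C Rl <= <<X>>)%VS.
  apply/span_subvP => _ /imageP[j _ ->]; rewrite -/(A j) adjacencyE.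
  apply: memv_suml => k _; apply: memvZ; apply: memv_span.
  by apply/mapP; exists k; rewrite ?mem_enum.
move/sub_BX/coord_span=> {1}->; exists (fun k => coord X k F).
by apply: eq_bigr => k _; rewrite (nth_mktuple E).
Qed.

Let E_comb_mul f k : (\sum_l f l *: E l) *m E k = f k *: E k.
Proof.
rewrite mulmx_suml (bigD1 k) //= big1 => [|l lk].
  by rewrite addr0 -scalemxAl E_mul eqxx.
by rewrite -scalemxAl E_mul (negPf lk) scaler0.
Qed.

Let E_comb_inj f g :
  \sum_k f k *: E k = \sum_k g k *: E k -> forall k, f k = g k.
Proof.
move=> fg k; have /eqP := congr1 (fun M => M *m E k) fg.
by rewrite !E_comb_mul -subr_eq0 -scalerBl scaler_eq0 (negPf (E_neq0 k)) orbF
  subr_eq0 => /eqP.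
Qed.

Let E_combM f g : (\sum_k f k *: E k) *m (\sum_k g k *: E k)
  = \sum_k (f k * g k) *: E k.
Proof.
rewrite mulmx_sumr; apply: eq_bigr => k _.
by rewrite -scalemxAr E_comb_mul scalerA mulrC.
Qed.

Let bm_idempotentP F : bm_idempotent Rl F ->
  exists2 c : 'I_d.+1 -> C,
    F = \sum_k c k *: E k & forall k, c k = 0 \/ c k = 1.
Proof.
case=> /bmP[c Fc] FF; exists c => // k.
move: FF; rewrite Fc E_combM => /E_comb_inj/(_ k)/eqP.
rewrite -subr_eq0 -{3}[c k]mulr1 -mulrBr mulf_eq0 subr_eq0.
by case/orP=> /eqP; [left | right].
Qed.

Let E_idempotent k : bm_idempotent Rl (E k).
Proof. by split; [apply: memE | rewrite E_mul eqxx]. Qed.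

Let E_comb1 k : E k = \sum_l (l == k)%:R *: E l.
Proof.
rewrite (bigD1 k) //= eqxx scale1r big1 ?addr0 // => l /negPf->.
by rewrite scale0r.
Qed.

(** Both summands have coefficients 0 or 1 with product 0. Away from [k] the coefficients add up to
    0, so both vanish; at [k] one of them vanishes. *)
Let E_primitive k : primitive_idempotent Rl (E k).
Proof.
split=> // F1 F2 /bm_idempotentP[f -> f01] /bm_idempotentP[g -> g01].
rewrite E_combM => fg0 _; rewrite -big_split /= E_comb1.
under [RHS]eq_bigr do rewrite -scalerDl.
move=> /E_comb_inj fgD.
have {}fg0 l : f l * g l = 0.
  apply: (E_comb_inj (f := fun l => f l * g l) (g := fun=> 0)).
  by rewrite fg0 big1 // => m _; rewrite scale0r.
have off l : l != k -> f l = 0 /\ g l = 0.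
  move=> /negPf lk; have /eqP := fgD l; have /eqP := fg0 l.
  rewrite lk (eq_sym 0) /=.
  by case: (f01 l) => ->; case: (g01 l) => ->;
    rewrite ?addr0 ?add0r ?mulr1 ?eqxx ?oner_eq0.
have /eqP := fg0 k; rewrite mulf_eq0 => /orP[] /eqP hk; [left | right];
  rewrite big1 // => l _; have [->|/off[fl gl]] := eqVneq l k;
  by rewrite ?hk ?fl ?gl scale0r.
Qed.

Let primitiveE F : primitive_idempotent Rl F -> exists k, F = E k.
Proof.
case=> idF F0 Fmin; have [c Fc c01] := bm_idempotentP idF.
have [k ck|c0] := pickP (fun k => c k == 1); last first.
  case/eqP: F0; rewrite Fc big1 // => k _.
  by case: (c01 k) => [->|/eqP]; [rewrite scale0r | rewrite c0].
move/eqP in ck; exists k.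
have FE : F *m E k = E k by rewrite Fc E_comb_mul ck scale1r.
have EF : E k *m F = E k.
  by rewrite {1}E_comb1 Fc E_combM -[RHS]FE Fc [in RHS]E_comb1 E_combM;
    under eq_bigr do rewrite mulrC.
have EE : E k *m E k = E k by rewrite E_mul eqxx.
(* [F] splits orthogonally as [E k + (F - E k)], so primitivity leaves only [F - E k = 0]. *)
have [||||//||/eqP] := Fmin (E k) (F - E k).
- exact: E_idempotent.
- split; first by apply: memvB; [case: idF | apply: memE].
  by rewrite mulmxBl !mulmxBr EE FE EF subrr subr0; case: idF => _ ->.
- by rewrite mulmxBr EF EE subrr.
- by rewrite mulmxBl FE EE subrr.
- by rewrite addrC subrK.
- by move/eqP; rewrite (negPf (E_neq0 k)).
- by rewrite subr_eq0 => /eqP.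
Qed.

(** The number is an entry of [A i *m A j], and this product is diagonal in the basis [E]; the
    right-hand side depends on [x] and [y] only through [l]. *)
Let inter_numberE i j l x y : y - x \in S l ->
  (inter_number Rl i j x y)%:R = \sum_k P k i * P k j * (n^-1 * P l k).
Proof.
move=> yx; transitivity ((A i *m A j) (enum_rank x) (enum_rank y)).
  rewrite mxE /inter_number -sum1_card natr_sum big_mkcond /=.
  transitivity (\sum_z (x - z \in S i)%:R * (z - y \in S j)%:R : C).
    by apply: eq_bigr => z _; rewrite !inE -natrM mulnb; case: ifP.
  by rewrite -sum_enum; apply: eq_bigr => z _; rewrite !A_entry !enum_rankK.
rewrite !adjacencyE E_combM summxE; apply: eq_bigr => k _.
by rewrite mxE (@E_entry _ l) ?enum_rankK.
Qed.

Theorem translation_scheme :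
  [/\ association_scheme Rl, commutative_relations Rl & first_eigenmatrix Rl P].
Proof.
split.
- split.
  + by apply/setP => p; rewrite !inE S_0 inE subr_eq0.
  + by move=> i; have [x xi] := S_neq0 i; apply/set0Pn; exists (x, 0);
      rewrite inE /= subr0.
  + move=> p; have [i pi] := S_cover (p.1 - p.2); exists i.
    by split=> [|j]; rewrite inE // => /(S_uniq pi).
  + move=> i; have [j Hj] := S_opp i; exists j; apply/setP => p.
    by rewrite !inE /= -Hj opprB.
  (* [Rl k] constrains [x - y] whereas [inter_numberE] reads [y - x], hence the opposite class [l].
     The pair [(x, 0)] serves as a sample of [Rl k]. *)
  + move=> i j k; have [x xk] := S_neq0 k; have [l Hl] := S_opp k.
    exists (inter_number Rl i j x 0) => y z; rewrite inE /= => yz.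
    apply/eqP; rewrite -(eqr_nat C) !(@inter_numberE _ _ l) //.
      by rewrite -Hl opprB subr0.
    by rewrite -Hl opprB.
- move=> i j x y; rewrite /inter_number.
  (* The involution sending [z] to [x + y - z] exchanges the differences [x - z] and [z - y]. *)
  rewrite -[RHS](card_preimset _ (inv_inj (subKr (x + y)))).
  congr #|pred_of_set _|; apply/setP => z; rewrite !inE /= andbC.
  have -> : x - (x + y - z) = z - y by rewrite opprB opprD addrCA addNKr.
  by rewrite [x + y - z - y]addrAC addrK.
exists E; split.
- move=> k l Ekl; apply/eqP; apply: contraTT (E_neq0 k) => /negPf kl.
  by have := E_mul k l; rewrite -Ekl E_mul eqxx kl => ->; rewrite eqxx.
- by apply/matrixP => x y; rewrite !mxE S_0 big_set1 B0x.
- move=> F; split; [exact: primitiveE | by case=> k ->].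
- exact: adjacencyE.
Qed.
End TranslationScheme.

(** * The trace character of a field of order [2 ^ e] *)

Section TraceCharacter.

Variables (K : finFieldType) (e : nat) (C : numClosedFieldType).

Hypothesis card_K : #|K| = (2 ^ e)%N.
Hypothesis pchar_K : 2 \in [pchar K].
Hypothesis e_odd : odd e.

Let Tr : K -> K := abs_trace e.

Let sqrD (x y : K) : (x + y) ^+ 2 = x ^+ 2 + y ^+ 2.
Proof. by rewrite sqrrD mulr2n addrr_pchar2 ?addr0 // pchar_K. Qed.

Lemma abs_traceD x y : Tr (x + y) = Tr x + Tr y.
Proof.
rewrite /Tr /abs_trace -big_split /=; apply: eq_bigr => k _.
elim: (k : nat) => [|m IHm]; first by rewrite !expr1.
by rewrite expnS mulnC !exprM IHm sqrD.
Qed.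

Lemma abs_trace0 : Tr 0 = 0.
Proof. by apply: (addrI (Tr 0)); rewrite -abs_traceD !addr0. Qed.

(** Squaring shifts the terms of the trace cyclically because [x ^+ (2 ^ e) = x], so the trace is a
    root of [t ^+ 2 - t]. *)
Lemma abs_trace_idem x : (Tr x == 0) || (Tr x == 1).
Proof.
suff : Tr x ^+ 2 = Tr x.
  move/eqP; rewrite -subr_eq0 expr2 -{3}[Tr x]mulr1 -mulrBr mulf_eq0 subr_eq0.
  by [].
rewrite /Tr /abs_trace.
have -> : (\sum_(k < e) x ^+ (2 ^ k)) ^+ 2 = \sum_(k < e) x ^+ (2 ^ k.+1).
  rewrite (big_morph (fun y => y ^+ 2) sqrD (expr0n _ 2)).
  by apply: eq_bigr => k _; rewrite -exprM mulnC -expnS.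
(* Adding the missing first term turns both sides into sums over [e.+1] terms up to the last one,
   which is [x] again. *)
apply: (addrI (x ^+ (2 ^ 0))).
transitivity (\sum_(k < e.+1) x ^+ (2 ^ k)); first by rewrite big_ord_recl.
by rewrite big_ord_recr /= -card_K expf_card addrC expr1.
Qed.

Lemma abs_trace1 : Tr 1 = 1.
Proof.
rewrite /Tr /abs_trace; under eq_bigr do rewrite expr1n.
rewrite sumr_const card_ord -[e]odd_double_half e_odd -mul2n natrD natrM.
by rewrite (pcharf0 pchar_K) mul0r addr0.
Qed.

Definition tr_sign (x : K) : C := (-1) ^+ (abs_trace e x != 0).

Lemma tr_sign_add x y : tr_sign (x + y) = tr_sign x * tr_sign y.
Proof.
rewrite /tr_sign -!/(Tr _) abs_traceD.
case/orP: (abs_trace_idem x) => /eqP->; case/orP: (abs_trace_idem y) => /eqP->;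
  rewrite ?addr0 ?add0r ?eqxx ?oner_eq0 ?mulr1 ?mul1r //.
by rewrite addrr_pchar2 ?pchar_K // eqxx -expr2 sqrr_sign.
Qed.

Lemma tr_sign_eq1 x : (tr_sign x == 1) = (abs_trace e x == 0).
Proof.
rewrite /tr_sign; case: (abs_trace e x == 0) => /=; first by rewrite eqxx.
by rewrite expr1 eq_sym -subr_eq0 opprK -mulr2n pnatr_eq0.
Qed.

Lemma tr_sign0 : tr_sign 0 = 1.
Proof. by rewrite /tr_sign -/(Tr 0) abs_trace0 eqxx. Qed.

Lemma tr_sign1 : tr_sign 1 = -1.
Proof. by rewrite /tr_sign -/(Tr 1) abs_trace1 oner_eq0. Qed.

(** For nonzero [a], translating [x] by [a^-1] multiplies each term by [tr_sign 1 = -1]. *)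
Lemma sum_tr_sign a : \sum_x tr_sign (a * x) = (2 ^ e)%:R * (a == 0)%:R.
Proof.
have [->|a0] := eqVneq a 0.
  under eq_bigr do rewrite mul0r tr_sign0.
  by rewrite sumr_const card_K mulr1.
rewrite mulr0; set s := \sum_x _.
suff : s = - s by move/eqP; rewrite -addr_eq0 -mulr2n mulrn_eq0 => /eqP.
rewrite {1}/s (reindex_inj (addrI a^-1)) -sumrN /=; apply: eq_bigr => x _.
by rewrite mulrDr divff // tr_sign_add tr_sign1 mulN1r.
Qed.

(* The indicator of trace zero is (1 + tr_sign) / 2. *)
Lemma sum_tr_sign_ker a :
  \sum_(x | abs_trace e x == 0) tr_sign (a * x) =
  2%:R ^+ (e - 1) * ((a == 0)%:R + (a == 1)%:R).
Proof.
have two_neq0 : 2%:R != 0 :> C by rewrite pnatr_eq0.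
have e_gt0 : (0 < e)%N by case: (e) e_odd.
apply: (mulfI two_neq0).
transitivity (\sum_x (tr_sign (a * x) + tr_sign ((a + 1) * x))).
  rewrite big_mkcond mulr_sumr; apply: eq_bigr => x _.
  rewrite (mulrDl a) mul1r tr_sign_add [X in _ = _ + _ * X]/tr_sign.
  by case: eqP => _ /=; rewrite ?expr0 ?expr1; ring.
rewrite big_split /= !sum_tr_sign -mulrDr mulrA -exprS subn1 prednK // natrX.
by rewrite addr_eq0 oppr_pchar2 // pchar_K.
Qed.

End TraceCharacter.

(** * Character sums over the Galois ring *)

Section GaloisRing.

Variables (e : nat) (Phi : {poly 'Z_4}) (K : finFieldType) (zeta : K).
Variable C : numClosedFieldType.

Local Notation GR := {poly %/ Phi}.

(** Abstract form of reduction modulo 2. With 4 = 0, the hypotheses on its kernel identify it both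
    with the multiples of 2 and with the annihilator of 2. *)
Variable red : {rmorphism GR -> K}.

Hypothesis e_odd : odd e.
Hypothesis card_K : #|K| = (2 ^ e)%N.
Hypothesis red_surj : forall t, exists x, red x = t.
Hypothesis red_eq0 : forall x, red x = 0 -> exists y, x = 2%:R * y.
Hypothesis mul2_eq0 : forall x : GR, 2%:R * x = 0 -> red x = 0.
Hypothesis red_xi : red (xi Phi) = zeta.
Hypothesis xi_order : xi Phi ^+ (2 ^ e - 1) = 1.
Hypothesis zeta_gen :
  forall t, t != 0 -> exists2 j, (j < 2 ^ e - 1)%N & t = zeta ^+ j.

Let e_gt0 : (0 < e)%N. Proof. by case: (e) e_odd. Qed.

Let N := (2 ^ e)%N.

Let N_half : N = (2 * 2 ^ e.-1)%N.
Proof. by rewrite -expnS prednK. Qed.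

Lemma coef0_natr n : (n%:R : GR)`_0 = n%:R.
Proof. by rewrite qpolyC_natr -polyC_natr coefC. Qed.

Lemma four_eq0 : 2%:R * 2%:R = 0 :> GR.
Proof.
rewrite -natrM; apply: val_inj; apply: etrans (qpolyC_natr Phi _) _.
by rewrite -polyC_natr (_ : (2 * 2)%:R = 0) //; apply: val_inj.
Qed.

Let residue2_eq0 : red 2%:R = 0.
Proof.
apply/eqP; have /eqP := congr1 red four_eq0.
by rewrite rmorphM rmorph0 mulf_eq0 orbb.
Qed.

Let K_two_eq0 : 2%:R = 0 :> K.
Proof. by rewrite -(rmorph_nat red). Qed.

Lemma residue_pchar2 : 2 \in [pchar K].
Proof. by rewrite inE /= K_two_eq0. Qed.

Let eq_red x y : red x = red y -> exists w, x = y + 2%:R * w.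
Proof.
move=> rxy; have [|w xy] := @red_eq0 (x - y).
  by rewrite rmorphB rxy subrr.
by exists w; rewrite -xy addrC subrK.
Qed.

Let dbl_red x y : red x = red y -> 2%:R * x = 2%:R * y.
Proof. by move=> /eq_red[w ->]; rewrite mulrDr mulrA four_eq0 mul0r addr0. Qed.

(* Squares only depend on residues because (y + 2 w)^2 = y^2 + 4 (y w + w^2). *)
Lemma sqr_red x y : red x = red y -> x ^+ 2 = y ^+ 2.
Proof.
move=> /eq_red[w ->]; transitivity (y ^+ 2 + (2%:R * 2%:R) * (y * w + w ^+ 2)).
  by ring.
by rewrite four_eq0 mul0r addr0.
Qed.

Let expN_red x y : red x = red y -> x ^+ N = y ^+ N.
Proof. by move=> /sqr_red xy; rewrite N_half !exprM xy. Qed.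

(** * The Teichmueller lift *)

Let lift (t : K) : GR := odflt 0 [pick x | red x == t].

Let liftK t : red (lift t) = t.
Proof.
rewrite /lift; case: pickP => [x /eqP //|].
by have [x <-] := red_surj t; move/(_ x); rewrite eqxx.
Qed.

(** As [N] is even, this power does not depend on the lift chosen; as [N] is the order of [K], it
    preserves the residue. Multiplicativity follows from the first point. *)
Definition teich_lift t := lift t ^+ N.

Local Notation tau := teich_lift.

Lemma teich_liftE x : x ^+ N = tau (red x).
Proof. by apply: expN_red; rewrite liftK. Qed.

Lemma red_teich_lift t : red (tau t) = t.
Proof. by rewrite rmorphXn liftK /N -card_K expf_card. Qed.

Let tauM s t : tau (s * t) = tau s * tau t.
Proof. by rewrite -exprMn; apply: expN_red; rewrite rmorphM !liftK. Qed.

Let tau0 : tau 0 = 0.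
Proof. by rewrite -(rmorph0 red) -teich_liftE expr0n expn_eq0. Qed.

Let tau1 : tau 1 = 1.
Proof. by rewrite -(rmorph1 red) -teich_liftE expr1n. Qed.

Let tauX t n : tau (t ^+ n) = tau t ^+ n.
Proof. by elim: n => [|n IH]; rewrite ?expr0 ?tau1 // !exprS tauM IH. Qed.

Let tau_zeta : tau zeta = xi Phi.
Proof.
rewrite -red_xi -teich_liftE -[N](@subnK 1) ?expn_gt0 //.
by rewrite addn1 exprS xi_order mulr1.
Qed.

Let zeta_neq0 : zeta != 0.
Proof.
apply/eqP => z0; have /eqP := congr1 red xi_order.
rewrite rmorphXn rmorph1 red_xi z0 expr0n subn_eq0 leqNgt.
by rewrite (@ltn_exp2l 2 0) // e_gt0 eq_sym oner_eq0.
Qed.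

(** [xi] is its own [N]-th power, hence [tau zeta]; the powers of [zeta] exhaust the nonzero
    residues. *)
Lemma teichE : teich e Phi = [set tau t | t : K & t != 0].
Proof.
apply/setP => x; apply/imsetP/imsetP => [[j _ ->]|[t]].
  by exists (zeta ^+ j); rewrite ?inE ?expf_neq0 // tauX tau_zeta.
rewrite inE => /zeta_gen[j lt_j ->] ->; exists (Ordinal lt_j) => //.
by rewrite tauX tau_zeta.
Qed.

Let teich0P x : reflect (x = tau (red x)) (x \in 0 |: teich e Phi).
Proof.
rewrite in_setU1 teichE; apply: (iffP orP) => [[/eqP->|/imsetP[t _ ->]]|->].
- by rewrite rmorph0 tau0.
- by rewrite red_teich_lift.
- have [->|] := eqVneq (red x) 0; first by left; rewrite tau0.
  by move=> rx; right; apply/imsetP; exists (red x); rewrite ?inE.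
Qed.

(** * The maximal ideal as a copy of the residue field *)

Definition ideal_lift t : GR := 2%:R * lift t.

Local Notation D := ideal_lift.

Lemma ideal_liftE x : 2%:R * x = D (red x).
Proof. by apply: dbl_red; rewrite liftK. Qed.

Let red_D t : red (D t) = 0.
Proof. by rewrite rmorphM residue2_eq0 mul0r. Qed.

Let DD s t : D (s + t) = D s + D t.
Proof. by rewrite -mulrDr; apply: dbl_red; rewrite rmorphD !liftK. Qed.

Let D0 : D 0 = 0.
Proof. by apply: (addrI (D 0)); rewrite -DD !addr0. Qed.

Let D1 : D 1 = 2%:R.
Proof. by rewrite -(rmorph1 red) -ideal_liftE mulr1. Qed.

(** The ring acts on its maximal ideal through residues. *)
Let mulD x t : x * D t = D (red x * t).
Proof. by rewrite mulrCA ideal_liftE rmorphM liftK. Qed.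

Let D_inj : injective D.
Proof.
move=> s t /eqP; rewrite -subr_eq0 -mulrBr => /eqP/mul2_eq0/eqP.
by rewrite rmorphB !liftK subr_eq0 => /eqP.
Qed.

Let DN t : - D t = D t.
Proof.
apply/eqP; rewrite eq_sym -addr_eq0 -DD.
by rewrite addrr_pchar2 ?residue_pchar2 ?D0.
Qed.

Lemma teich_decomp x : exists t, x = tau (red x) + D t.
Proof.
have [|w ->] := @eq_red x (tau (red x)); first by rewrite red_teich_lift.
exists (red w); rewrite -ideal_liftE rmorphD rmorphM residue2_eq0 mul0r addr0.
by rewrite red_teich_lift.
Qed.

(** * Frobenius map and trace *)

Lemma frobE a t : frob e (tau a + D t) = tau (a ^+ 2) + D (t ^+ 2).
Proof.
(* The search succeeds, as [(tau a, tau t)] qualifies. Whatever pair it returns, the residue fixes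
   the first digit and injectivity of [D] fixes the residue of the second. *)
rewrite /frob /teich_digits; case: pickP => [[x y] /=|]; last first.
  move/(_ (tau a, tau t)) => /=; case/and3P; split.
  - by apply/teich0P; rewrite red_teich_lift.
  - by apply/teich0P; rewrite red_teich_lift.
  - by rewrite ideal_liftE red_teich_lift.
case/and3P => /teich0P-> /teich0P yE /eqP; rewrite ideal_liftE => eq_xy.
have ra : red x = a.
  have := congr1 red eq_xy.
  by rewrite !rmorphD !red_D !red_teich_lift !addr0.
move: eq_xy; rewrite ra => /addrI/D_inj ->.
by rewrite -tauX ideal_liftE rmorphXn.
Qed.

(** The inverse of squaring on [K]. *)
Let sqrt (a : K) := a ^+ (2 ^ e.-1).

Let sqrtK a : sqrt a ^+ 2 = a.
Proof. by rewrite -exprM mulnC -N_half /N -card_K expf_card. Qed.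

Let K_sqrD (x y : K) : (x + y) ^+ 2 = x ^+ 2 + y ^+ 2.
Proof. by rewrite sqrrD -mulr_natl K_two_eq0 mul0r addr0. Qed.

Lemma teich_liftD a b : tau a + tau b = tau (a + b) + D (sqrt (a * b)).
Proof.
rewrite -{2}[a]sqrtK -{2}[b]sqrtK -K_sqrD tauX.
(* [tau (sqrt a + sqrt b)] and the sum of the two lifts have the same residue, hence the same
   square; expanding it yields the cross term [2 tau (sqrt (a * b))], which cancels as [D] takes
   values of additive order at most 2. *)
rewrite (@sqr_red _ (tau (sqrt a) + tau (sqrt b))); last first.
  by rewrite rmorphD !red_teich_lift.
rewrite sqrrD -!tauX !sqrtK -tauM /sqrt -exprMn -mulr_natl.
rewrite ideal_liftE red_teich_lift [X in _ = X + _]addrAC -[RHS]addrA -DD.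
by rewrite addrr_pchar2 ?residue_pchar2 ?D0 ?addr0.
Qed.

Lemma frobD (x y : GR) : frob e (x + y) = frob e x + frob e y.
Proof.
have [s ->] := teich_decomp x; have [t ->] := teich_decomp y.
set a := red x; set b := red y.
have -> : tau a + D s + (tau b + D t) =
    tau (a + b) + D (sqrt (a * b) + (s + t)).
  by rewrite addrACA teich_liftD !DD !addrA.
(* The two carries agree: squaring [sqrt (a * b)] gives [a * b], which is also the square root of
   [a ^+ 2 * b ^+ 2]. *)
rewrite !frobE !K_sqrD sqrtK addrACA teich_liftD !DD -!addrA.
by rewrite -exprMn /sqrt exprAC sqrtK.
Qed.

Lemma iter_frobD k (x y : GR) :
  iter k (@frob e Phi) (x + y) =
  iter k (@frob e Phi) x + iter k (@frob e Phi) y.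
Proof. by elim: k => //= k ->; rewrite frobD. Qed.

Lemma gtraceD (x y : GR) : gtrace e (x + y) = gtrace e x + gtrace e y.
Proof.
rewrite /gtrace -coefD -poly_of_qpolyD -big_split /=.
by under eq_bigr do rewrite iter_frobD.
Qed.

Lemma gtrace1 : gtrace e (1 : GR) = e%:R.
Proof.
rewrite /gtrace (eq_bigr (fun=> 1)) => [|k _].
  by rewrite sumr_const card_ord coef0_natr.
elim: (k : nat) => //= m ->.
by rewrite -tau1 -[tau 1]addr0 -D0 frobE !(expr1n, expr0n).
Qed.

Lemma gtrace_ideal t :
  gtrace e (D t) = (if abs_trace e t == 0 then 0 else 2%:R).
Proof.
(* On the ideal [frob] squares the residue, so the conjugates of [D t] add up to [D] of the absolute
   trace. *)
have -> : gtrace e (D t) = (D (abs_trace e t))`_0.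
  rewrite /gtrace; congr (_`_0); congr polyn.
  rewrite (big_morph D DD D0); apply: eq_bigr => k _.
  elim: (k : nat) => [|m /= ->]; first by rewrite expr1.
  by rewrite -[D _]add0r -tau0 frobE expr0n tau0 add0r -exprM mulnC -expnS.
have [->|] := eqVneq; first by rewrite D0 coef0.
case/orP: (abs_trace_idem card_K residue_pchar2 t) => /eqP->; rewrite ?eqxx //.
by rewrite D1 coef0_natr.
Qed.

(** * The additive character of the Galois ring *)

Local Notation chi := (chi e C).

Let i4 : ('i : C) ^+ 4 = 1.
Proof. by rewrite (exprM _ 2 2) sqrCi sqrrN expr1n. Qed.

Let i_mod n : 'i ^+ (n %% 4) = 'i ^+ n :> C.
Proof. exact: expr_mod. Qed.

Lemma chiD (x y : GR) : chi (x + y) = chi x * chi y.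
Proof.
rewrite /Defs.chi gtraceD -exprD -mulnDr -[LHS]i_mod -[RHS]i_mod /=.
by rewrite modnMmr.
Qed.

(** The trace of 1 is [e], so the exponent is [e * e], which is 1 modulo 4 for odd [e]; the factor
    [e] in [chi] normalizes this value. *)
Lemma chi1 : chi (1 : GR) = 'i.
Proof.
rewrite /Defs.chi gtrace1 -i_mod Zp_nat /= modnMmr.
rewrite -[e]odd_double_half e_odd -muln2; set k := e./2.
have -> : ((1 + k * 2) * (1 + k * 2) = (k * k + k) * 4 + 1)%N by ring.
by rewrite modnMDl.
Qed.

Lemma chi_ideal t : chi (D t) = tr_sign e C t.
Proof.
rewrite /Defs.chi gtrace_ideal /tr_sign; case: eqP => _ /=.
  by rewrite muln0.
by rewrite mulnC exprM sqrCi -(signr_odd _ e) e_odd.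
Qed.


Let chi0 : chi (0 : GR) = 1.
Proof. by rewrite -D0 chi_ideal tr_sign0 // residue_pchar2. Qed.

(** Since 4 = 0, [- x] equals [x + 2 x], and [2 x] is [D (red x)]. *)
Lemma chiN (x : GR) : chi (- x) = chi x * tr_sign e C (red x).
Proof.
rewrite -chi_ideal -chiD -ideal_liftE; congr chi.
rewrite -[LHS]addr0 -(mul0r x) -four_eq0 -natrM.
by ring.
Qed.

(** * Character sums over the ideal, the subgroup and the product sets *)

Local Notation P := (maxideal Phi).
Local Notation P0 := (maxideal0 e Phi zeta).
Local Notation H := (subgroupH e Phi zeta).
Local Notation trsgn := (tr_sign e C).

Lemma maxidealE : P = [set D t | t : K].
Proof.
apply/setP => x; apply/imsetP/imsetP => [[y _ ->]|[t _ ->]].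
  by exists (red y); rewrite ?ideal_liftE.
by exists (lift t).
Qed.

Lemma maxideal0E : P0 = [set D t | t : K & abs_trace e t == 0].
Proof.
have Tr0 : abs_trace e (0 : K) = 0 by rewrite abs_trace0 ?residue_pchar2.
apply/setP => x; rewrite in_setU1; apply/orP/imsetP.
  case=> [/eqP->|/imsetP[_ /imsetP[j /[!inE] Trj ->] ->]].
    by exists 0; rewrite ?inE ?Tr0 ?D0.
  exists (zeta ^+ j); rewrite ?inE //.
  by rewrite ideal_liftE rmorphXn red_xi.
case=> t /[!inE] Trt ->; have [->|t0] := eqVneq t 0.
  by left; rewrite D0.
right.
have [j lt_j tE] := zeta_gen t0; apply/imsetP.
exists (xi Phi ^+ j); last by rewrite ideal_liftE rmorphXn red_xi tE.
by apply/imsetP; exists (Ordinal lt_j); rewrite ?inE /= -?tE.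
Qed.

Lemma subgroupHP x :
  reflect (exists2 t, abs_trace e t = 0 & x = 1 + D t) (x \in H).
Proof.
rewrite /subgroupH maxideal0E; apply: (iffP imsetP).
  by case=> _ /imsetP[t /[!inE] /eqP Trt ->] ->; exists t.
case=> t Trt ->; exists (D t) => //.
by apply/imsetP; exists t; rewrite ?inE ?Trt.
Qed.

Local Notation lam := (lambda e C).

Let b : C := 2%:R ^+ (e - 1).
(** The sum of [trsgn (a * t)] over the [t] of trace zero: this character is trivial on the
    hyperplane exactly for [a] equal to 0 or 1. *)
Let hyperplane_sum (a : K) : C := b * ((a == 0)%:R + (a == 1)%:R).

Let chi_mulD x t : chi (x * D t) = trsgn (red x * t).
Proof. by rewrite mulD chi_ideal. Qed.

Lemma lambda_maxideal0 x : lam x P0 = hyperplane_sum (red x).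
Proof.
rewrite /lambda maxideal0E big_imset /=; last by move=> s t _ _; apply: D_inj.
under eq_bigr do rewrite chi_mulD.
rewrite /hyperplane_sum -sum_tr_sign_ker ?residue_pchar2 //.
by apply: eq_bigl => t; rewrite inE.
Qed.

Lemma lambda_maxideal x : lam x P = (2 ^ e)%:R * (red x == 0)%:R.
Proof.
rewrite /lambda maxidealE big_imset /=; last by move=> s t _ _; apply: D_inj.
under eq_bigr do rewrite chi_mulD.
by rewrite -(sum_tr_sign C) ?residue_pchar2.
Qed.

Lemma lambda_set0 x : lam x [set (0 : GR)] = 1.
Proof. by rewrite /lambda big_set1 mulr0 chi0. Qed.

Lemma lambda_setD x (A B : {set GR}) : B \subset A ->
  lam x (A :\: B) = lam x A - lam x B.
Proof.
move=> sBA; apply/eqP; rewrite eq_sym subr_eq addrC /lambda.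
by rewrite (big_setID B) /= (setIidPr sBA).
Qed.

Lemma zero_maxideal0 : 0 \in P0.
Proof. by rewrite in_setU1 eqxx. Qed.

Lemma maxideal0_sub : P0 \subset P.
Proof.
rewrite maxideal0E maxidealE; apply/subsetP => x /imsetP[t _ ->].
by apply/imsetP; exists t.
Qed.

Lemma lambda_subgroupH x : lam x H = chi x * hyperplane_sum (red x).
Proof.
rewrite /lambda /subgroupH big_imset /=; last by move=> y z _ _; apply: addrI.
under eq_bigr do rewrite mulrDr mulr1 chiD.
by rewrite -mulr_sumr -/(lam x P0) lambda_maxideal0.
Qed.

Lemma lambda_setopp x (A : {set GR}) : lam x (setopp A) = lam (- x) A.
Proof.
rewrite /lambda /setopp big_imset /=; last by move=> y z _ _; apply: oppr_inj.
by apply: eq_bigr => y _; rewrite mulrN mulNr.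
Qed.

Let tauV v : v != 0 -> tau v^-1 * tau v = 1.
Proof. by move=> v0; rewrite -tauM mulVf. Qed.

Let U := [set u : K | (u != 0) && (u != 1)].

Let teich_U : teich e Phi :\ (1 : GR) = [set tau u | u in U].
Proof.
rewrite teichE; apply/setP => x; rewrite in_setD1; apply/andP/imsetP.
  case=> x1 /imsetP[u /[!inE] u0 xE]; exists u => //; rewrite inE u0 /=.
  by apply: contraNneq x1 => u1; rewrite xE u1 tau1.
case=> u /[!inE] /andP[u0 u1] ->; split; last first.
  by apply/imsetP; exists u; rewrite ?inE.
by apply: contraNneq u1 => tu; rewrite -[u]red_teich_lift tu rmorph1.
Qed.

(** Elements of [A] have residue 1, so the residue of a product recovers its Teichmueller factor and
    the product map is injective on pairs. *)
Lemma lambda_setmul x (A : {set GR}) : (forall y, y \in A -> red y = 1) ->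
  lam x (setmul (teich e Phi :\ (1 : GR)) A) = \sum_(u in U) lam (x * tau u) A.
Proof.
move=> redA; rewrite teich_U.
have -> : setmul [set tau u | u in U] A = [set tau p.1 * p.2 | p in setX U A].
  apply/setP => z; apply/imset2P/imsetP => [[_ y /imsetP[u uU ->] yA ->]|].
    by exists (u, y); rewrite ?in_setX ?uU.
  case=> [[u y]] /=; rewrite in_setX => /andP[/= uU yA] ->.
  by exists (tau u) y => //; apply/imsetP; exists u.
rewrite /lambda big_imset /=; last first.
  case=> [u y] [v z]; rewrite !in_setX !inE /=.
  move=> /andP[/andP[u0 _] /redA ry] /andP[_ /redA rz] eq_uv.
  have uv : u = v.
    by have := congr1 red eq_uv; rewrite !rmorphM !red_teich_lift ry rz !mulr1.
  move: eq_uv; rewrite -uv => /(congr1 (fun w => tau u^-1 * w)).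
  by rewrite !mulrA tauV // !mul1r => ->.
rewrite pair_big_dep /=; apply: eq_big => [[u y]|[u y] _] /=.
  by rewrite in_setX.
by rewrite mulrA.
Qed.

Let red_H y : y \in H -> red y = 1.
Proof. by case/subgroupHP=> t _ ->; rewrite rmorphD rmorph1 red_D addr0. Qed.

Let redN x : red (- x) = red x.
Proof. by rewrite rmorphN oppr_pchar2 // residue_pchar2. Qed.

Let red_oppH y : y \in setopp H -> red y = 1.
Proof. by case/imsetP=> z /red_H rz ->; rewrite redN. Qed.

Local Notation S1 := (setmul (teich e Phi :\ (1 : GR)) H).
Local Notation S2 := (setmul (teich e Phi :\ (1 : GR)) (setopp H)).

Lemma lambda_S2 x : lam x S2 = lam (- x) S1.
Proof.
rewrite !lambda_setmul //.
by apply: eq_bigr => u _; rewrite lambda_setopp mulNr.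
Qed.

Lemma lambda_S1_ideal s :
  lam (D s) S1 = b * (2%:R * b * (s == 0)%:R - 1 - trsgn s).
Proof.
rewrite lambda_setmul; last exact: red_H.
transitivity (b * \sum_(u in U) trsgn (s * u)).
  rewrite mulr_sumr; apply: eq_bigr => u _.
  rewrite lambda_subgroupH rmorphM red_D mul0r /hyperplane_sum eqxx.
  rewrite eq_sym oner_eq0 addr0 mulr1 mulrC; congr (_ * _).
  by rewrite mulrC chi_mulD red_teich_lift mulrC.
congr (_ * _).
have -> : 2%:R * b = (2 ^ e)%:R :> C.
  by rewrite /b -exprS subn1 prednK // natrX.
rewrite -(sum_tr_sign C card_K residue_pchar2 e_odd s).
(* [U] omits 0 and 1, whose terms [1] and [trsgn s] are taken off the full sum. *)
rewrite [in RHS](bigD1 0) //= [in RHS](bigD1 1) ?oner_eq0 //= mulr0 mulr1.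
rewrite tr_sign0 ?residue_pchar2 // [1 + _]addrC addrK addrAC subrr add0r.
by apply: eq_bigl => u; rewrite inE.
Qed.

(** The hyperplane sum at [red x * u] survives only for [u] inverse to [red x], and this [u] lies in
    [U] unless [red x = 1]. *)
Lemma lambda_S1_unit x : red x != 0 ->
  lam x S1 = (red x != 1)%:R * (b * chi (x * tau (red x)^-1)).
Proof.
move=> x0; rewrite lambda_setmul; last exact: red_H.
have termE u : u != 0 ->
    lam (x * tau u) H = (u == (red x)^-1)%:R * (b * chi (x * tau u)).
  move=> u0; rewrite lambda_subgroupH rmorphM red_teich_lift /hyperplane_sum.
  rewrite mulf_eq0 (negPf x0) (negPf u0) add0r -(inj_eq (mulfI x0) u) mulfV //.
  by rewrite mulrC -mulrA mulrCA.
have [x1|x1] := eqVneq (red x) 1.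
  rewrite mul0r big1 // => u /[!inE] /andP[u0 /negPf u1].
  by rewrite termE // x1 invr1 u1 mul0r.
rewrite (bigD1 (red x)^-1) /=; last by rewrite inE invr_eq0 invr_eq1 x0.
rewrite termE ?invr_eq0 // eqxx !mul1r big1 ?addr0 // => u /andP[].
by rewrite inE => /andP[u0 _] /negPf ux; rewrite termE // ux mul0r.
Qed.

(** * Membership in the classes, read off residues and character values *)

Let unit_decomp x : red x != 0 -> exists u, x * tau (red x)^-1 = 1 + D u.
Proof.
move=> x0; have [s xE] := teich_decomp x; exists (s * (red x)^-1).
by rewrite {1}xE mulrDl mulrC tauV // mulrC mulD red_teich_lift mulrC.
Qed.

Let chi_unit u : chi (1 + D u) = 'i * trsgn u.
Proof. by rewrite chiD chi1 chi_ideal. Qed.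

Let i_neq0 : 'i != 0 :> C. Proof. exact: neq0Ci. Qed.

(** On elements [1 + D u] the character is ['i * trsgn u], so its value tells whether [u] has trace
    zero. *)
Lemma mem_subgroupH x : (x \in H) = (red x == 1) && (chi x == 'i).
Proof.
apply/subgroupHP/andP => [[t Trt ->]|[/eqP x1]].
  rewrite rmorphD rmorph1 red_D addr0 eqxx chi_unit.
  by have /eqP -> : trsgn t == 1; rewrite ?tr_sign_eq1 ?Trt ?mulr1.
have [|u] := @unit_decomp x; first by rewrite x1 oner_eq0.
rewrite x1 invr1 tau1 mulr1 => ->; rewrite chi_unit -{2}['i]mulr1.
by rewrite (inj_eq (mulfI i_neq0)) tr_sign_eq1 => /eqP; exists u.
Qed.

Lemma mem_setopp_subgroupH x :
  (x \in setopp H) = (red x == 1) && (chi x == - 'i).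
Proof.
have -> : (x \in setopp H) = (- x \in H).
  apply/imsetP/idP => [[y yH ->]|xH]; first by rewrite opprK.
  by exists (- x); rewrite ?opprK.
rewrite mem_subgroupH redN chiN; case: eqP => //= ->.
by rewrite tr_sign1 ?residue_pchar2 // mulrN1 eqr_oppLR.
Qed.

Lemma mem_setmul x (A : {set GR}) : (forall y, y \in A -> red y = 1) ->
  (x \in setmul (teich e Phi :\ (1 : GR)) A) =
  [&& red x != 0, red x != 1 & x * tau (red x)^-1 \in A].
Proof.
move=> redA; rewrite teich_U; apply/imset2P/and3P.
  case=> _ y /imsetP[u /[!inE] /andP[u0 u1] ->] yA ->.
  rewrite rmorphM red_teich_lift redA // mulr1; split=> //.
  by rewrite mulrAC [tau u * _]mulrC tauV // mul1r.
case=> x0 x1 xA; exists (tau (red x)) (x * tau (red x)^-1) => //.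
  by apply/imsetP; exists (red x); rewrite // inE x0.
by rewrite mulrC -mulrA tauV ?mulr1.
Qed.

Let red_unit x : red x != 0 -> red (x * tau (red x)^-1) = 1.
Proof. by move=> x0; rewrite rmorphM red_teich_lift mulfV. Qed.

Let mem_P x : (x \in P) = (red x == 0).
Proof.
rewrite maxidealE; apply/imsetP/eqP => [[t _ ->]|/red_eq0[w ->]].
  exact: red_D.
by exists (red w); rewrite ?ideal_liftE.
Qed.

Let i_neq_Ni : ('i == - 'i :> C) = false.
Proof. by rewrite -addr_eq0 -mulr2n mulrn_eq0 (negPf i_neq0). Qed.

(** One function giving the class of [x]: that the classes cover the ring and are disjoint then
    needs no separate argument. *)
Definition Sset_index (x : GR) : nat :=
  if red x == 0 then
    if x == 0 then 0%N else if x \in P0 then 5%N else 6%N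
  else if red x == 1 then if chi x == 'i then 3%N else 4%N
  else if chi (x * tau (red x)^-1) == 'i then 1%N else 2%N.

Lemma ltn_Sset_index x : (Sset_index x < 7)%N.
Proof. by rewrite /Sset_index; do ![case: ifP]. Qed.

Let unit_chi x : red x = 1 -> chi x = 'i \/ chi x = - 'i.
Proof.
move=> x1; have [|u] := @unit_decomp x; first by rewrite x1 oner_eq0.
rewrite x1 invr1 tau1 mulr1 => ->; rewrite chi_unit /tr_sign.
by case: eqP => _; [left | right]; rewrite ?mulr1 ?mulrN1.
Qed.

Let S := Sset e Phi zeta.

Let P0_red x : x \in P0 -> red x = 0.
Proof. by move/(subsetP maxideal0_sub); rewrite mem_P => /eqP. Qed.

Lemma mem_Sset x i : (x \in S i) = (Sset_index x == i :> nat).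
Proof.
have chiE y : red y = 1 -> (chi y == - 'i) = (chi y != 'i).
  by case/unit_chi=> ->; rewrite ?eqxx ?i_neq_Ni // eq_sym i_neq_Ni.
have -> : (x \in S i) = nth false [:: x == 0;
   [&& red x != 0, red x != 1 & chi (x * tau (red x)^-1) == 'i];
   [&& red x != 0, red x != 1 & chi (x * tau (red x)^-1) != 'i];
   (red x == 1) && (chi x == 'i); (red x == 1) && (chi x != 'i);
   (x != 0) && (x \in P0); (red x == 0) && (x \notin P0)] i.
  rewrite /S /Sset (tnth_nth set0).
  case: i => [[|[|[|[|[|[|[|//]]]]]]] ?] /=.
  - by rewrite inE.
  - rewrite mem_setmul //; have [//|x0] := eqVneq (red x) 0.
    by rewrite mem_subgroupH red_unit // eqxx.
  - rewrite mem_setmul //; have [//|x0] := eqVneq (red x) 0.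
    by rewrite mem_setopp_subgroupH red_unit // eqxx chiE // red_unit.
  - exact: mem_subgroupH.
  - by rewrite mem_setopp_subgroupH; case: eqP => // /chiE ->.
  - by rewrite in_setD1.
  - by rewrite in_setD mem_P andbC.
have red0 : x = 0 -> red x = 0 by move->; rewrite rmorph0.
rewrite /Sset_index; have [x0|x0] := eqVneq (red x) 0.
  rewrite x0 [_ == 1 :> K]eq_sym oner_eq0 /=.
  have [xx|xx] := boolP (x == 0); last first.
    by case: ifP => _; case: i => [[|[|[|[|[|[|[|//]]]]]]] ?].
  rewrite (eqP xx) zero_maxideal0.
  by case: i => [[|[|[|[|[|[|[|//]]]]]]] ?].
have -> : (x == 0) = false by apply: contraNF x0 => /eqP /red0 ->.
have -> : (x \in P0) = false by apply: contraNF x0 => /P0_red ->.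
by have [x1|x1] := eqVneq (red x) 1; case: ifP => _;
  case: i => [[|[|[|[|[|[|[|//]]]]]]] ?].
Qed.

(** * The table of character sums *)

Let bE : (2 ^ e)%:R = 2%:R * b :> C.
Proof. by rewrite /b -exprS subn1 prednK // natrX. Qed.

Lemma lambda_Sset x j : lam x (S j) =
  nth 0 [:: 1; lam x S1; lam (- x) S1; chi x * hyperplane_sum (red x);
    chi (- x) * hyperplane_sum (red x); hyperplane_sum (red x) - 1;
    2%:R * b * (red x == 0)%:R - hyperplane_sum (red x)] j.
Proof.
rewrite /S /Sset (tnth_nth set0).
case: j => [[|[|[|[|[|[|[|//]]]]]]] ?] /=.
- exact: lambda_set0.
- by [].
- exact: lambda_S2.
- exact: lambda_subgroupH.
- by rewrite lambda_setopp lambda_subgroupH redN.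
- rewrite lambda_setD ?sub1set ?zero_maxideal0 //.
  by rewrite lambda_maxideal0 lambda_set0.
- by rewrite lambda_setD ?maxideal0_sub // lambda_maxideal0 lambda_maxideal bE.
Qed.

Let K01 : (0 == 1 :> K) = false.
Proof. by rewrite eq_sym oner_eq0. Qed.

(** Residue 0 gives rows 0, 5 and 6, told apart by [s = 0] and the sign [trsgn s]; residue 1 gives
    rows 3 and 4, the other residues rows 1 and 2, told apart by a character value ['i] or
    [- 'i]. *)
Lemma lambda_eigen_table i j x : x \in S i -> lam x (S j) = eigen_table C e i j.
Proof.
rewrite mem_Sset lambda_Sset mxE -/b /hyperplane_sum /Sset_index => /eqP <-.
have [x0|x0] := eqVneq (red x) 0.
  have [s xE] : exists s, x = D s.
    by have [w ->] := red_eq0 x0; exists (red w); rewrite ideal_liftE.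
  have Ds0 : (D s == 0) = (s == 0) by rewrite -D0 (inj_eq D_inj).
  have DsP0 : (D s \in P0) = (abs_trace e s == 0).
    rewrite maxideal0E; apply/imsetP/idP => [[t /[!inE] Trt /D_inj->] //|Trs].
    by exists s; rewrite ?inE.
  rewrite x0 ?eqxx K01 xE DN lambda_S1_ideal chi_ideal Ds0 DsP0.
  have [->|s0] := eqVneq s 0.
    rewrite tr_sign0 ?residue_pchar2 //.
    by case: j => [[|[|[|[|[|[|[|//]]]]]]] ?] /=; ring.
  rewrite /tr_sign; case: (abs_trace e s == 0);
    by case: j => [[|[|[|[|[|[|[|//]]]]]]] ?] /=; ring.
have [x1|x1] := eqVneq (red x) 1.
  rewrite !lambda_S1_unit ?redN ?x1 ?oner_eq0 ?eqxx ?mul0r //.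
  rewrite chiN x1 tr_sign1 ?residue_pchar2 //.
  case: (unit_chi x1) => ->; rewrite ?eqxx 1?[- 'i == _]eq_sym ?i_neq_Ni;
    by case: j => [[|[|[|[|[|[|[|//]]]]]]] ?] /=; ring.
rewrite !lambda_S1_unit ?redN // ?x1 ?(negPf x0) (mulNr x) !chiN red_unit //.
rewrite tr_sign1 ?residue_pchar2 //.
case: (unit_chi (red_unit x0)) => ->;
  rewrite ?eqxx 1?[- 'i == _]eq_sym ?i_neq_Ni;
  by case: j => [[|[|[|[|[|[|[|//]]]]]]] ?] /=; ring.
Qed.

Lemma Sset_opp i : exists j, forall x, (- x \in S i) = (x \in S j).
Proof.
(* Negation keeps residues and is the identity on the ideal; off the ideal it changes the sign of
   the character value, which swaps 1 with 2 and 3 with 4. *)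
pose op (k : nat) := nth 0%N [:: 0; 2; 1; 4; 3; 5; 6]%N k.
have lt_op : (op i < 7)%N.
  by rewrite /op; case: i => [[|[|[|[|[|[|[|//]]]]]]] ?].
have opK k : (k < 7)%N -> op (op k) = k by case: k => [|[|[|[|[|[|[|]]]]]]].
exists (Ordinal lt_op) => x; rewrite !mem_Sset /=.
suff -> : Sset_index (- x) = op (Sset_index x).
  by apply/eqP/eqP => [<-|->]; rewrite opK ?ltn_Sset_index.
rewrite /Sset_index redN oppr_eq0.
have [x0|x0] := eqVneq (red x) 0.
  have [w ->] := red_eq0 x0; rewrite ideal_liftE DN.
  by case: eqP => // _; case: ifP.
have [x1|x1] := eqVneq (red x) 1.
  rewrite chiN x1 tr_sign1 ?residue_pchar2 //.
  case: (unit_chi x1) => ->;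
    by rewrite mulrN1 ?opprK ?eqxx ?[- 'i == _]eq_sym i_neq_Ni.
rewrite mulNr chiN red_unit // tr_sign1 ?residue_pchar2 //.
case: (unit_chi (red_unit x0)) => ->;
  by rewrite mulrN1 ?opprK ?eqxx ?[- 'i == _]eq_sym i_neq_Ni.
Qed.

(** A nonzero [x] has a multiple equal to [D 1], where [chi] is -1; translating by the cofactor
    negates the sum. *)
Let chi_sum x : \sum_(y : GR) chi (x * y) = #|GR|%:R * (x == 0)%:R.
Proof.
have [->|x0] := eqVneq x 0.
  by under eq_bigr do rewrite mul0r chi0; rewrite sumr_const mulr1.
rewrite mulr0; set s := \sum_y _.
have [y xy] : exists y, x * y = D 1.
  have [rx0|rx0] := eqVneq (red x) 0.
    have [w xE] := red_eq0 rx0.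
    have w0 : red w != 0.
      by apply: contraNneq x0 => w0; rewrite xE ideal_liftE w0 D0.
    exists (lift (red w)^-1).
    by rewrite xE ideal_liftE mulrC mulD liftK mulVf.
  by exists (D (red x)^-1); rewrite mulD mulfV.
suff : s = - s by move/eqP; rewrite -addr_eq0 -mulr2n mulrn_eq0 => /eqP.
rewrite {1}/s (reindex_inj (addrI y)) -sumrN /=; apply: eq_bigr => z _.
by rewrite mulrDr xy chiD chi_ideal tr_sign1 ?residue_pchar2 // mulN1r.
Qed.

Hypothesis e_gt1 : (1 < e)%N.

(** The factor [b - 1] is nonzero because [e] exceeds 1. *)
Lemma eigen_table_row0_neq0 j : eigen_table C e ord0 j != 0.
Proof.
have b0 : b != 0 by rewrite expf_neq0 // pnatr_eq0.
have b1 : b - 1 != 0.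
  rewrite subr_eq0 /b -natrX pnatr_eq1 -(expn0 2) eqn_exp2l //.
  by rewrite subn_eq0 -ltnNge.
have two0 : 2%:R != 0 :> C by rewrite pnatr_eq0.
rewrite mxE -/b; case: j => [[|[|[|[|[|[|[|//]]]]]]] ?] /=;
  by rewrite ?mulf_neq0 ?oner_eq0.
Qed.

Theorem galois_scheme : let Rl := Rrel e Phi zeta in
  [/\ association_scheme Rl, commutative_relations Rl,
      ~ symmetric_relations Rl & first_eigenmatrix Rl (eigen_table C e)].
Proof.
have [|||||||||scheme comm eig] := @translation_scheme (GR : finZmodType) C 6
    (fun x y : GR => chi (x * y)) S (eigen_table C e).
- by move=> x y; rewrite mulrC.
- by move=> x y z; rewrite mulrDl chiD.
- exact: chi_sum.
- by rewrite /S /Sset (tnth_nth set0).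
- by move=> x; exists (Ordinal (ltn_Sset_index x)); rewrite mem_Sset.
- exact: Sset_opp.
- by move=> i j x; apply: lambda_eigen_table.
- by move=> x i j; rewrite !mem_Sset => /eqP-> /eqP/val_inj.
- exact: eigen_table_row0_neq0.
(* Class 3 is not closed under negation: it contains 1 but not -1, as [chi (- 1) = - 'i]. *)
split=> // /(_ (inord 3))/setP/(_ (1, 0)).
rewrite !inE /= -/S subr0 sub0r !mem_Sset /Sset_index redN rmorph1 oner_eq0.
rewrite eqxx.
rewrite chiN rmorph1 tr_sign1 ?residue_pchar2 // chi1 mulrN1 eqxx.
by rewrite [- 'i == _]eq_sym i_neq_Ni inordK.
Qed.

End GaloisRing.

(** * The residue morphism *)

Lemma red2_is_zmod_morphism : zmod_morphism red2.
Proof.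
by case=> [[|[|[|[|//]]]] ?] [[|[|[|[|//]]]] ?]; apply: val_inj.
Qed.

Lemma red2_is_monoid_morphism : monoid_morphism red2.
Proof.
split=> [|[[|[|[|[|//]]]] ?] [[|[|[|[|//]]]] ?]]; exact: val_inj.
Qed.

HB.instance Definition _ :=
  GRing.isZmodMorphism.Build _ _ red2 red2_is_zmod_morphism.
HB.instance Definition _ :=
  GRing.isMonoidMorphism.Build _ _ red2 red2_is_monoid_morphism.

Lemma red2_eq0 (a : 'Z_4) : (red2 a == 0) = (2%:R * a == 0).
Proof. by case: a => [[|[|[|[|//]]]] ?]. Qed.

Lemma red2_half (a : 'Z_4) : red2 a = 0 -> a = (a : nat)./2%:R *+ 2.
Proof. by move/eqP; case: a => [[|[|[|[|//]]]] ?] // _; apply: val_inj. Qed.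

Section Residue.

Variables (e : nat) (phi : {poly 'F_2}) (phi_prim : primitive_poly phi).

Let K := {poly %/ phi with primitive_mi phi_prim}.

Variables (zeta : K) (Phi : {poly 'Z_4}).

Hypothesis e_gt1 : (1 < e)%N.
Hypothesis phi_deg : size phi = e.+1.
Hypothesis zeta_root :
  root (map_poly (qfpoly_const (primitive_mi phi_prim)) phi) zeta.
Hypothesis Phi_monic : Phi \is monic.
Hypothesis Phi_red : map_poly red2 Phi = phi.
Hypothesis Phi_dvd : exists Q : {poly 'Z_4}, 'X^(2 ^ e - 1) - 1 = Q * Phi.

Local Notation GR := {poly %/ Phi}.

Let c : {rmorphism 'F_2 -> K} := qpolyC phi.

Let ev (p : {poly 'F_2}) : K := (map_poly c p).[zeta].

Lemma card_residue : #|K| = (2 ^ e)%N.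
Proof. by rewrite card_qfpoly phi_deg card_Fp. Qed.

(** Otherwise irreducibility makes [phi] coprime to [p], although both vanish at [zeta]. *)
Let ev_eq0 p : ev p = 0 -> phi %| p.
Proof.
move=> p0; apply: contraT; have [irr _] := primitive_mi phi_prim.
rewrite -irreducible_poly_coprime // -(coprimep_map c) => cop.
by have /eqP := coprimep_root cop zeta_root.
Qed.

Let zeta_neq0 : zeta != 0.
Proof.
apply/eqP => z0; have /dvdp_leq : phi %| 'X.
  by apply: ev_eq0; rewrite /ev map_polyX hornerX.
by rewrite polyX_eq0 size_polyX phi_deg ltnS leqNgt e_gt1 => /(_ isT).
Qed.

(** Primitivity keeps [phi] from dividing ['X^n - 1] for [0 < n < 2 ^ e - 1], so the powers of
    [zeta] below that exponent are distinct; counting shows that they fill [K] minus 0. *)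
Lemma residue_gen (t : K) :
  t != 0 -> exists2 j, (j < 2 ^ e - 1)%N & t = zeta ^+ j.
Proof.
have [_ _] := primitive_polyP _ phi_prim.
rewrite -[#|_|]/#|K| card_residue -subn1; set v := (2 ^ e - 1)%N => ordv.
have zeta_exp n : (0 < n < v)%N -> zeta ^+ n != 1.
  move=> n_v; apply: contra (ordv n n_v) => /eqP zn; apply: ev_eq0.
  by rewrite /ev rmorphB rmorph1 /= map_polyXn !hornerE zn subrr.
pose f (i : 'I_v) := zeta ^+ i.
have f_inj : injective f.
  suff lt_f (i j : 'I_v) : (i < j)%N -> f i != f j.
    move=> i j fij; apply: ord_inj; case: (ltngtP i j) => // /lt_f.
      by rewrite fij eqxx.
    by rewrite fij eqxx.
  move=> ij; have /zeta_exp : (0 < j - i < v)%N.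
    by rewrite subn_gt0 ij (leq_ltn_trans (leq_subr _ _)).
  apply: contraNneq => fij; apply/eqP/(mulIf (expf_neq0 i zeta_neq0)).
  by rewrite -exprD subnK ?(ltnW ij) // mul1r.
have fE : [set f i | i : 'I_v] = [set~ 0].
  apply/eqP; rewrite eqEcard; apply/andP; split.
    by apply/subsetP => _ /imsetP[i _ ->]; rewrite !inE expf_neq0.
  by rewrite card_imset // cardsC1 card_ord /v subn1 -card_residue.
move=> t0; have : t \in [set f i | i : 'I_v] by rewrite fE !inE.
by case/imsetP => i _ ->; exists i.
Qed.

(** * Reduction from the Galois ring to its residue field *)

Let size_Phi : size Phi = e.+1.
Proof.
rewrite -phi_deg -Phi_red size_map_poly_id0 //.
by rewrite (monicP Phi_monic) rmorph1 oner_eq0.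
Qed.

(** The quotient type works modulo [mk_monic Phi], which falls back on a default for unsuitable
    polynomials; here the fallback does not occur. *)
Let mkPhi : mk_monic Phi = Phi.
Proof. by rewrite /mk_monic Phi_monic size_Phi ltnS (ltnW e_gt1). Qed.

Let ev4 (p : {poly 'Z_4}) : K := ev (map_poly red2 p).

Let ev4_is_zmod_morphism : zmod_morphism ev4.
Proof. by move=> p q; rewrite /ev4 /ev !rmorphB hornerD hornerN. Qed.

Let ev4M p q : ev4 (p * q) = ev4 p * ev4 q.
Proof. by rewrite /ev4 /ev !rmorphM hornerM. Qed.

(** Division by [Phi] removes a multiple of [Phi], whose reduction [phi] vanishes at [zeta]; this
    makes [residue] multiplicative. *)
Let ev4_mod p : ev4 (in_qpoly Phi p) = ev4 p.
Proof.
rewrite /= mkPhi {2}(Pdiv.RingMonic.rdivp_eq Phi_monic p).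
rewrite /ev4 /ev !(rmorphD, rmorphM) /= hornerD hornerM Phi_red.
by rewrite (eqP (zeta_root : root (map_poly c phi) zeta)) mulr0 add0r.
Qed.

Definition residue (x : GR) : K := ev4 x.

Let residue_is_zmod_morphism : zmod_morphism residue.
Proof. by move=> x y; exact: ev4_is_zmod_morphism. Qed.

Let residue_is_monoid_morphism : monoid_morphism residue.
Proof.
split; first by rewrite /residue /ev4 /ev !rmorph1 hornerC.
move=> x y; rewrite /residue -ev4M; exact: ev4_mod.
Qed.

Definition residue_morphism : {rmorphism GR -> K} :=
  HB.pack residue
    (GRing.isZmodMorphism.Build GR K residue residue_is_zmod_morphism)
    (GRing.isMonoidMorphism.Build GR K residue residue_is_monoid_morphism).

Lemma residue_xi : residue (xi Phi) = zeta.
Proof. by rewrite /residue ev4_mod /ev4 /ev !map_polyX hornerX. Qed.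

Lemma xi_order : xi Phi ^+ (2 ^ e - 1) = 1.
Proof.
have [Q XQ] := Phi_dvd; apply/eqP; rewrite -subr_eq0 /xi -rmorphXn.
rewrite -(rmorph1 (in_qpoly Phi)) -rmorphB /= XQ rmorphM /=.
suff -> : in_qpoly Phi Phi = 0 by rewrite mulr0.
by apply: val_inj; rewrite /= mkPhi Pdiv.RingMonic.rmodpp.
Qed.

(** The reduced representative is a multiple of [phi] of degree below [e]. *)
Let red_coef_eq0 (x : GR) : residue x = 0 -> map_poly red2 x = 0.
Proof.
move/ev_eq0 => phi_x; apply/eqP; apply: contraT => x0.
have := dvdp_leq x0 phi_x; rewrite phi_deg leqNgt => /negP[].
apply: leq_ltn_trans (size_poly _ _) _.
by apply: leq_trans (size_mk_monic x) _; rewrite mkPhi size_Phi.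
Qed.

Lemma residue_eq0 (x : GR) : residue x = 0 -> exists y, x = 2%:R * y.
Proof.
(* All coefficients are even, so halving them one by one gives the cofactor of 2. *)
move/red_coef_eq0 => x0; pose half (a : 'Z_4) : 'Z_4 := (a : nat)./2%:R.
exists (in_qpoly Phi (map_poly half x)); rewrite mulr_natl -rmorphMn /=.
have -> : map_poly half x *+ 2 = x.
  apply/polyP => i; rewrite coefMn coef_map_id0 // -red2_half //.
  by rewrite -coef_map x0 coef0.
by apply: val_inj; apply: esym; apply/in_qpoly_small/size_mk_monic.
Qed.

Lemma residue_mul2 (x : GR) : 2%:R * x = 0 -> residue x = 0.
Proof.
move=> x0; suff red0 : map_poly red2 x = 0.
  by rewrite /residue /ev4 /ev red0 rmorph0 horner0.
apply/polyP => i; rewrite coef_map coef0; apply/eqP; rewrite red2_eq0.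
have x2 : x + x = 0 by rewrite -mulr2n -mulr_natl.
by rewrite mulr_natl mulr2n -coefD -poly_of_qpolyD x2 coef0.
Qed.

Lemma residue_surj (t : K) : exists x, residue x = t.
Proof.
have [->|/residue_gen[j _ ->]] := eqVneq t 0.
  by exists 0; exact: (rmorph0 residue_morphism).
exists (xi Phi ^+ j).
apply: etrans (rmorphXn residue_morphism _ _) _.
by congr (_ ^+ _); exact: residue_xi.
Qed.

End Residue.

Theorem theorem4p5 (C : numClosedFieldType) (e : nat)
    (e_ge3 : (3 <= e)%N) (e_odd : odd e)
    (phi : {poly 'F_2}) (phi_deg : size phi = e.+1)
    (phi_prim : primitive_poly phi)
    (zeta : {poly %/ phi with primitive_mi phi_prim})
    (zeta_root : root (map_poly (qfpoly_const (primitive_mi phi_prim)) phi) zeta)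
    (Phi : {poly 'Z_4}) (Phi_monic : Phi \is monic)
    (Phi_red : map_poly red2 Phi = phi)
    (Phi_dvd : exists Q : {poly 'Z_4}, 'X^(2 ^ e - 1) - 1 = Q * Phi) :
  let S := Sset e Phi zeta in
  let Rl := Rrel e Phi zeta in
  let P := eigen_table C e in
  (forall (i j : 'I_7) (alpha : {poly %/ Phi}),
      alpha \in S i -> lambda e C alpha (S j) = P i j) /\
  [/\ association_scheme Rl,
      commutative_relations Rl,
      ~ symmetric_relations Rl
    & first_eigenmatrix Rl P].
Proof.
have e_gt1 : (1 < e)%N := ltnW e_ge3.
(* Evaluation at [zeta] after reduction modulo 2 realizes the abstract [red]; the facts that follow
   discharge its hypotheses. *)
pose red := residue_morphism e_gt1 phi_deg zeta_root Phi_monic Phi_red.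
have card_K := card_residue phi_prim phi_deg.
have red_surj : forall t, exists x, red x = t.
  exact: (residue_surj e_gt1 phi_deg zeta_root Phi_monic Phi_red).
have red_eq0 : forall x, red x = 0 -> exists y, x = 2%:R * y.
  exact: (residue_eq0 e_gt1 phi_deg zeta_root Phi_monic Phi_red).
have red_mul2 : forall x, 2%:R * x = 0 -> red x = 0.
  by move=> x; exact: residue_mul2.
have red_xi : red (xi Phi) = zeta.
  exact: (residue_xi e_gt1 phi_deg zeta_root Phi_monic Phi_red).
have xi1 : xi Phi ^+ (2 ^ e - 1) = 1.
  exact: (xi_order e_gt1 phi_deg Phi_monic Phi_red Phi_dvd).
have zeta_gen := residue_gen e_gt1 phi_deg zeta_root.
split.
  move=> i j alpha.
  exact: (lambda_eigen_table _ e_odd card_K red_surj red_eq0 red_mul2 red_xi).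
exact: (galois_scheme _ e_odd card_K red_surj red_eq0 red_mul2 red_xi).
Qed.
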